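(* Let $G$ be a finite group and $H,K$ subgroups of $G$ such that $\mathrm{Mid}_G(H,K)\neq\emptyset$. Put $\mathcal{C}^{(-1)}(H,K):=\mathrm{Mid}_G(H,K)$, fix $g_0\in\mathcal{C}^{(-1)}(H,K)$, and construct sequences $\{g_n\}_{n\geq 0}$ and $\{\mathcal{C}^{(n)}(H,K)\}_{n\geq -1}$ as follows (procedure MSFA). If $g_0,\dots,g_n$ and $\mathcal{C}^{(-1)}(H,K),\dots,\mathcal{C}^{(n-1)}(H,K)$ have been defined for an integer $n\geq 0$, set $$\mathcal{C}^{(n)}(H,K):=\mathcal{C}^{(n-1)}(H,K)\cap (Hg_nK)^c,$$ and then, if $\mathcal{C}^{(n)}(H,K)$ is nonempty, choose an (arbitrary) element $g_{n+1}\in\mathcal{C}^{(n)}(H,K)$ and put $X_n:=\{g_0,\dots,g_{n+1}\}$; also $X_{-1}:=\{g_0\}$. Then, for any choices made in the procedure, there is a least integer $N\geq 0$ such that $\mathcal{C}^{(N)}(H,K)=\emptyset$ (equivalently, $HX_{N-1}K=\mathrm{Mid}_G(H,K)$). Putting $X:=X_{N-1}$, the product $HXK$ is direct, and $X$ is (non-empty and) maximal relative to the direct product $H\cdot X\cdot K$. Moreover, every subset $\chi\subseteq G$ such that the product $H\chi K$ is direct and $\chi$ is maximal relative to the direct product $H\cdot\chi\cdot K$ can be obtained from this procedure, i.e. it equals the output $X_{N-1}$ for some admissible choice of $g_0,g_1,\dots,g_N$.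
   Context: For $S\subseteq G$, $S^c:=G\setminus S$. For subsets $A,X,B\subseteq G$, the product $AXB=\{axb: a\in A,x\in X,b\in B\}$ is called direct, written $AXB=A\cdot X\cdot B$, if every element of $AXB$ has a unique representation $axb$ with $a\in A$, $x\in X$, $b\in B$. The middle director of $(A,B)$ in $G$ is $$\mathrm{Mid}_G(A,B):=\{g\in G:\ \text{the product } A\{g\}B \text{ is direct}\}.$$ A subset $X\subseteq G$ with $HXK$ direct is maximal relative to the direct product $H\cdot X\cdot K$ if for every $S\subseteq G$ with $X\subsetneq S$ the product $HSK$ is not direct. *)

(* Defs.v *)
From HB Require Import structures.
From mathcomp Require Import all_boot all_fingroup.

Set Implicit Arguments.
Unset Strict Implicit.
Unset Printing Implicit Defensive.

Import GroupScope.

Section MiddleDirector.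

Variable gT : finGroupType.
Implicit Types (A B X G H K : {set gT}) (g : nat -> gT).

Definition representations A X B (y : gT) : {set gT * gT * gT} :=
  [set t | [&& t.1.1 \in A, t.1.2 \in X, t.2 \in B
             & t.1.1 * t.1.2 * t.2 == y]].

Definition direct A X B : bool :=
  [forall y in A * X * B, #|representations A X B y| == 1%N].

Definition Mid G A B : {set gT} := [set x in G | direct A [set x] B].

Definition maximal_direct G A X B : Prop :=
  [/\ X \subset G, direct A X B
    & forall S : {set gT}, S \subset G -> X \proper S -> ~~ direct A S B].

(* C^(n) for n >= 0, along the sequence g of choices; the predecessor of      *)
(* C^(0), i.e., C^(-1), is Mid G H K.                                         *)
Fixpoint msfaC G H K g (n : nat) : {set gT} :=
  (if n is m.+1 then msfaC G H K g m else Mid G H K)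
    :&: (G :\: H * [set g n] * K).

(* The choices are recorded in a total sequence: nothing is required of the   *)
(* terms that come after the first empty C^(n), and they are never used.      *)
Definition msfa_choices G H K g : Prop :=
  g 0%N \in Mid G H K /\
  forall n, msfaC G H K g n != set0 -> g n.+1 \in msfaC G H K g n.

Definition msfa_stops_at G H K g (N : nat) : Prop :=
  msfaC G H K g N = set0 /\ forall m, (m < N)%N -> msfaC G H K g m != set0.

(* Indices are shifted by one: msfaX g n is X_(n-1) = {g_0, ..., g_n}.        *)
Definition msfaX g (n : nat) : {set gT} := [set g i | i : 'I_n.+1].

End MiddleDirector.

(* Main.v *)
(** For subgroups H and K, the product H{x}K is direct or not according to the
    double coset HxK only, so Mid is a union of double cosets, and HXK is direct
    exactly when X consists of representatives of distinct double cosets inside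
    Mid.  The procedure picks such representatives one at a time, in any order,
    until all of Mid is covered; maximality of X means exactly HXK = Mid. *)

Require Import Defs.
From mathcomp Require Import all_boot all_fingroup.

Set Implicit Arguments.
Unset Strict Implicit.
Unset Printing Implicit Defensive.

Import GroupScope.

Lemma directP (gT : finGroupType) (A X B : {set gT}) :
  reflect (forall a x b a' x' b', a \in A -> x \in X -> b \in B ->
             a' \in A -> x' \in X -> b' \in B ->
             a * x * b = a' * x' * b' -> [/\ a = a', x = x' & b = b'])
          (direct A X B).
Proof.
apply: (iffP forall_inP) => [dAXB a x b a' x' b' Aa Xx Bb Aa' Xx' Bb' eq_axb|].
  have /dAXB/cards1P[t def_t] : a * x * b \in A * X * B by rewrite !mem_mulg.
  have: (a, x, b) \in representations A X B (a * x * b).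
    by rewrite inE /= Aa Xx Bb /=.
  have: (a', x', b') \in representations A X B (a * x * b).
    by rewrite inE /= Aa' Xx' Bb' eq_axb /=.
  by rewrite def_t !inE => /eqP<- /eqP[-> -> ->].
move=> inj _ /mulsgP[_ b /mulsgP[a x Aa Xx ->] Bb ->].
apply/cards1P; exists (a, x, b); apply/setP=> -[[a' x'] b'].
rewrite !inE /=; apply/and4P/eqP => [[Aa' Xx' Bb' /eqP eq_axb]|[-> -> ->]] //.
by have [-> -> ->] := inj _ _ _ _ _ _ Aa' Xx' Bb' Aa Xx Bb eq_axb.
Qed.

Lemma direct_sub (gT : finGroupType) (A X Y B : {set gT}) :
  X \subset Y -> direct A Y B -> direct A X B.
Proof.
move=> sXY /directP inj; apply/directP => a x b a' x' b' Aa Xx Bb Aa' Xx' Bb'.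
by apply: inj => //; apply: (subsetP sXY).
Qed.

Lemma mem_dcosets (gT : finGroupType) (A X B : {set gT}) (y : gT) :
  reflect (exists2 x, x \in X & y \in A :* x * B) (y \in A * X * B).
Proof.
apply: (iffP idP) => [/mulsgP[_ b /mulsgP[a x Aa Xx ->] Bb ->] | [x Xx]].
  by exists x => //; rewrite !mem_mulg ?set11.
by apply/subsetP; rewrite mulSg // mulgS // sub1set.
Qed.

Lemma dcosetP (gT : finGroupType) (A B : {set gT}) (x y : gT) :
  reflect (exists a b, [/\ a \in A, b \in B & y = a * x * b])
          (y \in A :* x * B).
Proof.
apply: (iffP mulsgP) => [[_ b /rcosetP[a Aa ->] Bb ->] | [a [b [Aa Bb ->]]]].
  by exists a, b.
by exists (a * x) b => //; apply/rcosetP; exists a.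
Qed.

Lemma dcoset_sym (gT : finGroupType) (H K : {group gT}) (x y : gT) :
  y \in H :* x * K -> x \in H :* y * K.
Proof.
case/dcosetP=> h [k [Hh Kk ->]]; apply/dcosetP; exists h^-1, k^-1.
by rewrite !groupV -!mulgA mulgV mulg1 mulKg.
Qed.

Lemma dcoset_refl (gT : finGroupType) (H K : {group gT}) (x : gT) :
  x \in H :* x * K.
Proof. by apply/dcosetP; exists 1, 1; rewrite !group1 mul1g mulg1. Qed.

Section DirectDoubleCosets.

Variables (gT : finGroupType) (G H K : {group gT}).
Hypotheses (sHG : H \subset G) (sKG : K \subset G).
Implicit Types (X : {set gT}) (g : nat -> gT).

Lemma Mid_subset : Mid G H K \subset G.
Proof. by apply/subsetP=> x; rewrite inE => /andP[]. Qed.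

(** For [y = h * x * k], an equality [a * y * b = a' * y * b'] reads [(a * h) * x * (k * b) = (a' *
    h) * x * (k * b')]; directness at [x] applies, and [h] and [k] cancel. *)
Lemma Mid_dcoset (x y : gT) :
  x \in Mid G H K -> y \in H :* x * K -> y \in Mid G H K.
Proof.
rewrite !inE => /andP[Gx /directP inj] /dcosetP[h [k [Hh Kk ->]]].
rewrite !groupM ?(subsetP sHG h) ?(subsetP sKG k) //=.
apply/directP=> a y1 b a' y2 b' Ha /set1P-> Kb Ha' /set1P-> Kb' eq_ab.
have [/mulIg-> _ /mulgI->] // : [/\ a * h = a' * h, x = x & k * b = k * b'].
by apply: inj; rewrite ?set11 ?groupM // !mulgA; rewrite !mulgA in eq_ab.
Qed.

(** Left to right, [1 * y * 1 = h * x * k] would be a second representation of [y]. Right to left,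
    [a * x * b = a' * x' * b'] places [x'] in the double coset of [x], whence [x' = x], and
    directness at [x] alone does the rest. *)
Lemma direct_dcosets X : X \subset G ->
  direct H X K <->
    X \subset Mid G H K /\ {in X &, forall x y, y \in H :* x * K -> y = x}.
Proof.
move=> sXG; split=> [dX | [/subsetP sXM disjX]].
  split=> [|x y Xx Xy /dcosetP[h [k [Hh Kk def_y]]]].
    apply/subsetP=> x Xx; rewrite inE (subsetP sXG) //=.
    by apply: direct_sub dX; rewrite sub1set.
  have /directP inj := dX.
  have [] // : [/\ 1 = h, y = x & 1 = k].
  by apply: inj; rewrite ?group1 // mul1g mulg1.
apply/directP=> a x b a' x' b' Ha Xx Kb Ha' Xx' Kb' eq_ab.
have eq_x : x' = x.
  apply: disjX => //; apply/dcosetP; exists (a'^-1 * a), (b * b'^-1).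
  split; rewrite ?groupM ?groupV //.
  by rewrite -!mulgA (mulgA x) (mulgA a) (mulgA a x b) eq_ab -!mulgA mulgV mulg1 mulKg.
have := sXM x Xx; rewrite inE => /andP[_ /directP inj].
by apply: inj; rewrite ?set11 // eq_x set11.
Qed.

Lemma direct_setU1 X (y : gT) : X \subset G -> direct H X K ->
  y \in Mid G H K :\: H * X * K -> direct H (y |: X) K.
Proof.
move=> sXG dX /setDP[My HXK'y]; have Gy := subsetP Mid_subset y My.
have [sXM disjX] := (direct_dcosets sXG).1 dX.
apply/direct_dcosets; first by rewrite subUset sub1set Gy.
split=> [|x z]; first by rewrite subUset sub1set My.
case/setU1P=> [->|Xx] /setU1P[->|Xz] // xz; last exact: disjX.
  by case/mem_dcosets: HXK'y; exists z; last exact: dcoset_sym.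
by case/mem_dcosets: HXK'y; exists x.
Qed.

(** A point of [Mid] left uncovered could be adjoined to [X]. Conversely, when all of [Mid] is
    covered, any new point of a larger direct [S] shares its double coset with some point of [X],
    which directness of [S] forbids. *)
Lemma maximal_directE X : direct H X K -> X \subset G ->
  maximal_direct G H X K <-> Mid G H K \subset H * X * K.
Proof.
move=> dX sXG; split=> [[_ _ maxX] | sMX].
  apply: contraT => /subsetPn[y My HXK'y].
  have X'y : y \notin X.
    by apply: contra HXK'y => Xy; apply/mem_dcosets; exists y; rewrite ?dcoset_refl.
  have /negP[] : ~~ direct H (y |: X) K.
    apply: maxX; last by rewrite properUr // sub1set.
    by rewrite subUset sub1set sXG (subsetP Mid_subset).
  by rewrite direct_setU1 // in_setD HXK'y.
split=> // S sSG /properP[sXS [s Ss X's]]; apply/negP.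
case/(direct_dcosets sSG)=> sSM disjS.
have /mem_dcosets[x Xx xs] := subsetP sMX s (subsetP sSM s Ss).
have eq_sx : s = x by apply: disjS => //; apply: (subsetP sXS).
by rewrite eq_sx Xx in X's.
Qed.

Lemma msfaX0 g : msfaX g 0 = [set g 0%N].
Proof.
apply/setP=> y; rewrite inE; apply/imsetP/eqP => [[i _ ->]|->].
  by rewrite ord1.
by exists ord0.
Qed.

Lemma msfaXS g n : msfaX g n.+1 = g n.+1 |: msfaX g n.
Proof.
apply/setP=> y; rewrite !inE; apply/imsetP/predU1P => [[i _ ->]|].
  have [-> | ne_in] := eqVneq (i : nat) n.+1; first by left.
  have lt_in : i < n.+1 by rewrite ltn_neqAle ne_in -ltnS ltn_ord.
  by right; apply/imsetP; exists (Ordinal lt_in).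
case=> [-> | /imsetP[i _ ->]]; first by exists ord_max.
by exists (widen_ord (leqnSn _) i).
Qed.

(** Unfolds the recursion: stopping at [n] becomes the covering condition of [maximal_directE], and
    a legal next choice becomes the hypothesis of [direct_setU1]. *)
Lemma msfaCE g n : msfaC G H K g n = Mid G H K :\: H * msfaX g n * K.
Proof.
have MDG (Y : {set gT}) : Mid G H K :&: (G :\: Y) = Mid G H K :\: Y.
  by rewrite setIDA (setIidPl Mid_subset).
elim: n => [|n IHn] /=; first by rewrite msfaX0 MDG.
rewrite IHn setIDAC MDG setDDl msfaXS; congr (_ :\: _).
apply/setP=> y; rewrite inE; apply/orP/mem_dcosets.
  case=> [yn | /mem_dcosets[x Xx xy]]; first by exists (g n.+1); rewrite ?setU11.
  by exists x; rewrite ?setU1r.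
case=> x /setU1P[-> | Xx] xy; first by left.
by right; apply/mem_dcosets; exists x.
Qed.

Lemma msfaC_eq0 g n m : n <= m -> msfaC G H K g n = set0 ->
  msfaC G H K g m = set0.
Proof.
move=> /subnK <-; elim: (m - n) => //= k IHk Cn0.
by rewrite IHk // set0I.
Qed.

Lemma msfaC_proper g n : msfa_choices G H K g ->
  msfaC G H K g n != set0 -> msfaC G H K g n.+1 \proper msfaC G H K g n.
Proof.
move=> [_ choose] /choose Cg; apply/properP; split; first exact: subsetIl.
by exists (g n.+1) => //=; rewrite !inE dcoset_refl andbF.
Qed.

Lemma msfa_stops g : msfa_choices G H K g ->
  exists N, msfa_stops_at G H K g N.
Proof.
move=> choices_g.
(* Each nonempty stage loses at least the element chosen from it. Subtraction is truncated, so the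
   bound is 0 at [n = #|gT|] and forces an empty stage. *)
have C_small n : #|msfaC G H K g n| <= #|gT| - n.
  elim: n => [|n IHn]; first by rewrite subn0 max_card.
  have [Cn0 | Cn_n0] := eqVneq (msfaC G H K g n) set0.
    by rewrite (msfaC_eq0 (leqnSn n)) ?cards0.
  rewrite subnS -ltnS (leq_trans (proper_card (msfaC_proper _ Cn_n0))) //.
  exact: leq_trans IHn (leqSpred _).
have exC : exists n, msfaC G H K g n == set0.
  by exists #|gT|; rewrite -cards_eq0 -leqn0 (leq_trans (C_small _)) ?subnn.
case: (ex_minnP exC) => N /eqP CN0 minN; exists N; split=> // m lt_mN.
by apply: contraL lt_mN => /minN; rewrite -leqNgt.
Qed.

Lemma msfaX_direct g n : msfa_choices G H K g ->
    (forall m, m < n -> msfaC G H K g m != set0) ->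
  msfaX g n \subset Mid G H K /\ direct H (msfaX g n) K.
Proof.
move=> [Mg0 choose]; elim: n => [_|n IHn Cn0].
  rewrite msfaX0 sub1set; split=> //.
  by have := Mg0; rewrite inE => /andP[].
have [|sXM dX] := IHn; first by move=> m lt_mn; rewrite Cn0 // ltnW.
have := choose n (Cn0 n (ltnSn n)); rewrite msfaCE msfaXS => Cg.
split; last by rewrite direct_setU1 // (subset_trans sXM Mid_subset).
by rewrite subUset sXM sub1set andbT; case/setDP: Cg.
Qed.

(** Serves the converse half of the theorem, where the choices are read off an enumeration of the
    given set. *)
Lemma msfaX_nth (x0 : gT) (s : seq gT) n :
  n < size s -> msfaX (nth x0 s) n = [set:: take n.+1 s].
Proof.
move=> lt_ns; apply/setP=> y; rewrite inE.
have sz : size (take n.+1 s) = n.+1 by rewrite size_takel.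
apply/imsetP/(nthP x0) => [[i _ ->] | [i]]; rewrite sz.
  by exists i; rewrite ?sz ?nth_take.
by move=> lt_in <-; exists (Ordinal lt_in); rewrite ?nth_take.
Qed.

End DirectDoubleCosets.

Theorem theorem2p10 (gT : finGroupType) (G H K : {group gT})
    (sHG : H \subset G) (sKG : K \subset G) (Mid_neq0 : Mid G H K != set0) :
  (forall g : nat -> gT, msfa_choices G H K g ->
    exists N : nat,
      [/\ msfa_stops_at G H K g N,
          (forall n : nat, (n <= N)%N ->
             (msfaC G H K g n = set0 <-> H * msfaX g n * K = Mid G H K)),
          direct H (msfaX g N) K,
          msfaX g N != set0
        & maximal_direct G H (msfaX g N) K])
  /\
  (forall chi : {set gT}, chi \subset G -> direct H chi K ->
     maximal_direct G H chi K ->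
     exists (g : nat -> gT) (N : nat),
       [/\ msfa_choices G H K g, msfa_stops_at G H K g N & chi = msfaX g N]).
Proof.
split=> [g choices_g | chi sXG dX maxX].
  have [N stopN] := msfa_stops choices_g; have [CN0 Cn0] := stopN.
  have [sXM dX] := msfaX_direct choices_g Cn0.
  have sXG := subset_trans sXM (Mid_subset G H K).
  exists N; split=> // [n le_nN | |].
  - have [||sXnM _] // := @msfaX_direct _ G H K g n.
      by move=> m lt_mn; rewrite Cn0 // (leq_trans lt_mn).
    rewrite msfaCE; split=> [/eqP|->]; last by rewrite setDv.
    (* Emptiness gives only one inclusion; the other holds because [Mid] is a union of double cosets
       and contains every chosen element. *)
    rewrite setD_eq0 => sMX; apply/eqP; rewrite eqEsubset sMX andbT.
    apply/subsetP=> y /mem_dcosets[x Xx]; apply: Mid_dcoset => //.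
    exact: (subsetP sXnM).
  - by apply/set0Pn; exists (g 0%N); apply/imsetP; exists ord0.
  - by apply/maximal_directE => //; rewrite -setD_eq0 -msfaCE CN0.
have sMX := (maximal_directE dX sXG).1 maxX.
have [sXM disjX] := (direct_dcosets H K sXG).1 dX.
(* Since [chi] covers the nonempty [Mid], it has an element [x1], so [#|chi|.-1] is a genuine last
   index; [x0] becomes the default value of [nth]. *)
have [x0 /(subsetP sMX)/mem_dcosets[x1 Xx1 _]] := set0Pn _ Mid_neq0.
have szX : size (enum chi) = #|chi|.-1.+1.
  by rewrite -cardE prednK // (cardD1 x1) Xx1.
pose g := nth x0 (enum chi); pose N := #|chi|.-1.
have Xg i : i <= N -> g i \in chi.
  by move=> le_iN; rewrite -mem_enum mem_nth // szX.
have XN : msfaX g N = chi.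
  by rewrite msfaX_nth ?szX // -szX take_size set_enum.
have CN0 : msfaC G H K g N = set0.
  by apply/eqP; rewrite msfaCE XN setD_eq0.
(* The enumeration has no repetition and distinct elements of [chi] have disjoint double cosets, so
   the next element is not yet covered. *)
have Cg n : n < N -> g n.+1 \in msfaC G H K g n.
  move=> lt_nN; rewrite msfaCE inE (subsetP sXM) ?Xg // andbT.
  apply/mem_dcosets=> -[_ /imsetP[i _ ->] gi_gn].
  have le_in : i <= n by rewrite -ltnS.
  have /eqP := disjX _ _ (Xg i (leq_trans le_in (ltnW lt_nN))) (Xg _ lt_nN) gi_gn.
  rewrite nth_uniq ?enum_uniq ?szX // ?ltnS; last by rewrite (leq_trans le_in) // ltnW.
  by move/eqP=> eq_ni; rewrite -eq_ni ltnn in le_in.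
exists g, N; split=> //; split=> //.
- by rewrite (subsetP sXM) ?Xg.
(* From [N] on every stage is empty, so the default terms of [g] are never subject to a choice
   condition. *)
- move=> n Cn_n0; apply: Cg; rewrite ltnNge; apply: contra Cn_n0 => le_Nn.
  by rewrite (msfaC_eq0 le_Nn).
- by move=> m lt_mN; apply/set0Pn; exists (g m.+1); apply: Cg.
Qed.
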